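(* Let $G$ be a locally compact Hausdorff topological group and let $f\in\mathrm{UC}(G)$. Then $f\in\mathrm{AP}(G)$ if and only if the rule $\circ$ given by $$x\circ y=z\quad\text{whenever } x=\alpha\xi_f,\ y=\gamma\xi_f,\ z=\alpha\gamma\xi_f\ \text{ with }\alpha,\gamma\in\beta G$$ is a (well-defined) binary operation on $X_f$ such that $(X_f,\circ)$, with the pointwise topology, is a compact Hausdorff topological group with identity $\xi_f$.
   Context: For $f:G\to\mathbb{C}$ and $t\in G$ let $(ft)(x)=f(tx)$ and $(tf)(x)=f(xt)$. $\mathrm{LUC}(G)$ (resp. $\mathrm{RUC}(G)$) is the set of bounded continuous $f:G\to\mathbb{C}$ such that $ft_n\to ft$ (resp. $t_nf\to tf$) in the supremum norm whenever $t_n\to t$ in $G$; $\mathrm{UC}(G)=\mathrm{LUC}(G)\cap\mathrm{RUC}(G)$. $f$ is left a.p. (von Neumann) if $Gf=\{tf:t\in G\}$ is relatively compact in $(\mathbb{C}^G,\|\cdot\|_\infty)$, right a.p. if $fG$ is; $\mathrm{AP}(G)$ is the set of functions that are both left and right a.p. Veech's hull: let $\xi_f:G\times G\to\mathbb{C}$, $\xi_f(s,t)=f(st)$. For bounded $x:G\times G\to\mathbb{C}$ and $\tau_1,\tau_2\in G$ put $(\tau_1x\tau_2)(s,t)=x(s\tau_1,\tau_2t)$. $X_f$ is the closure of $G\xi_f\,(=\xi_fG)$ in the topology of pointwise convergence; it is a compact Hausdorff space and both the left and right actions of $G$ on it are jointly continuous. $\beta G$ is the Stone–Čech compactification of $G$.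 For $\alpha\in\beta G$ and $x\in X_f$, $\alpha x:=\lim_n t_nx$ for any net $t_n\in G$ with $t_n\to\alpha$ in $\beta G$ (the continuous extension to $\beta G$ of $t\mapsto tx$), and $\alpha\gamma\xi_f$ means $\alpha(\gamma\xi_f)$. Every element of $X_f$ has the form $\alpha\xi_f$ with $\alpha\in\beta G$. *)

(* Defs.v *)
From HB Require Import structures.
From mathcomp Require Import all_boot all_order all_algebra.
From mathcomp Require Import complex.
From mathcomp Require Import all_classical all_reals all_analysis.

Set Implicit Arguments.
Unset Strict Implicit.
Unset Printing Implicit Defensive.

Import Order.TTheory GRing.Theory Num.Theory.
Import numFieldNormedType.Exports.

Local Open Scope classical_set_scope.
Local Open Scope ring_scope.

HB.mixin Record Group_isTopological G of Group G & Topological G := {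
  mulg_continuous : continuous (fun st : G * G => (st.1 * st.2)%g) ;
  invg_continuous : continuous (fun t : G => (t^-1)%g)
}.

#[short(type="topGroupType")]
HB.structure Definition TopGroup :=
  {G of Group G & Topological G & Group_isTopological G}.

(* The same notion for a bare binary operation [op] with identity [e] on a
   topological space, so that one can assert that a given rule is a
   topological group law. *)
Definition is_topological_group (T : topologicalType) (op : T -> T -> T)
    (e : T) : Prop :=
  [/\ associative op, left_id e op, right_id e op,
      continuous (fun xy : T * T => op xy.1 xy.2) &
      exists inv : T -> T,
        [/\ left_inverse e inv op, right_inverse e inv op & continuous inv]].

Lemma topGroup_is_topological_group (G : topGroupType) :
  is_topological_group (fun x y : G => (x * y)%g) 1%g.
Proof.
split; [exact: mulgA | exact: mul1g | exact: mulg1 | exact: mulg_continuous |].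
by exists (fun t => t^-1)%g; split; [exact: mulVg | exact: mulgV | exact: invg_continuous].
Qed.

(* Universal property, which determines [B] and [iota] up to a unique
   homeomorphism. *)
Definition is_stone_cech (T B : topologicalType) (iota : T -> B) : Prop :=
  [/\ compact [set: B], hausdorff_space B, continuous iota &
      forall (K : topologicalType) (h : T -> K),
        compact [set: K] -> hausdorff_space K -> continuous h ->
        exists! g : B -> K, continuous g /\ (forall t, g (iota t) = h t)].

Section Functions.
Context (R : realType) (G : topGroupType).
(* The alias [^o] gives R[i] the topology of its modulus. *)
Local Notation C := (R[i]^o).
Implicit Types (f : G -> C) (t : G).

(* [f t] *)
Definition ltrans f t : G -> C := fun x => f (t * x)%g.
(* [t f] *)
Definition rtrans t f : G -> C := fun x => f (x * t)%g.

(* Convergence in [{uniform G -> C}] is convergence in the supremum norm. *)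
Definition LUC : set (G -> C) :=
  [set f | [/\ bounded_fun f, continuous f &
    continuous (fun t => ltrans f t : {uniform G -> C})]].
Definition RUC : set (G -> C) :=
  [set f | [/\ bounded_fun f, continuous f &
    continuous (fun t => rtrans t f : {uniform G -> C})]].
Definition UC : set (G -> C) := LUC `&` RUC.

Definition left_ap f : Prop :=
  precompact (range (fun t => rtrans t f : {uniform G -> C})).
Definition right_ap f : Prop :=
  precompact (range (fun t => ltrans f t : {uniform G -> C})).
Definition AP : set (G -> C) := [set f | left_ap f /\ right_ap f].

Local Notation PW := {ptws (G * G)%type -> C}.

Definition xi f : PW := fun st => f (st.1 * st.2)%g.

(* The left action [tau x] on functions of two variables. *)
Definition lact (tau : G) (x : PW) : PW := fun st => x ((st.1 * tau)%g, st.2).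

Definition hull f : set PW := closure (range (fun tau => lact tau (xi f))).

Lemma xi_hull f : xi f \in hull f.
Proof.
apply/mem_set/subset_closure; exists 1%g => //.
by apply/funext => -[s t]; rewrite /lact /xi /= mulg1.
Qed.

Definition hull_xi f : hull f := exist _ (xi f) (xi_hull f).

(* The trace on G of the neighbourhood filter of [alpha]: a net (t_n) in G
   satisfies [iota t_n --> alpha] iff it is eventually in each of its members. *)
Definition trace_nbhs (B : topologicalType) (iota : G -> B) (alpha : B) :
    set_system G :=
  filter_from (nbhs alpha) (fun U => iota @^-1` U).

(* [z = alpha x], the limit of [t x] in the pointwise topology as [t] tends to
   [alpha]; such a [z] is unique since the limit is taken in a Hausdorff space. *)
Definition is_beta_act (B : topologicalType) (iota : G -> B) (alpha : B)
    (x z : PW) : Prop :=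
  (fun t => lact t x) @ trace_nbhs iota alpha --> z.

(* The graph of the rule [x o y = z]: [x = alpha xi_f], [y = gamma xi_f] and
   [z = alpha (gamma xi_f) = alpha y]. *)
Definition hull_rule (B : topologicalType) (iota : G -> B) f (x y z : hull f) :
    Prop :=
  exists alpha gamma : B,
    [/\ is_beta_act iota alpha (xi f) (set_val x),
        is_beta_act iota gamma (xi f) (set_val y) &
        is_beta_act iota alpha (set_val y) (set_val z)].

End Functions.

(* Main.v *)
Require Import Defs.
From HB Require Import structures.
From mathcomp Require Import all_boot all_order all_algebra.
From mathcomp Require Import complex.
From mathcomp Require Import all_classical all_reals all_analysis.

Set Implicit Arguments.
Unset Strict Implicit.
Unset Printing Implicit Defensive.

Import Order.TTheory GRing.Theory Num.Theory.
Import numFieldNormedType.Exports.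

Local Open Scope classical_set_scope.
Local Open Scope ring_scope.

(** Write [w tau] for the point [(s, t) |-> f (s tau t)] of the hull [X_f]. The
    orbit map [w] has dense range, and the supremum distance between [w tau] and
    [w sigma] does not change when both arguments are multiplied by the same
    group element, on either side. Multiplication and inversion of [G] are
    therefore uniformly continuous for this pseudo-distance, so on the completion
    of the orbit they extend to a group law.

    Suppose that [f] is almost periodic. Then pointwise convergence on [X_f] is
    the same as uniform convergence ([hull_near_uclose]), so [X_f], which is
    compact by Tychonoff's theorem, is that completion. To see it, take a filter
    along which [w tau] tends pointwise to [x]. For a fixed [t] the functions
    [s |-> f (s tau t)] stay in a compact set for the supremum norm, and on such a
    set pointwise convergence is uniform ([cvg_uniform_of_compact]); finitely many
    [t] are enough, up to a small error, because the right translates of [f] are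
    themselves covered by finitely many small balls. The product of [x] and [y] is
    then the only [z] such that [w tau], [w sigma] and [w (tau sigma)] can be taken
    as close as desired to [x], [y] and [z], uniformly and at the same time
    ([approx_mul]). The rule
    [x o y = z] implies this relation ([hull_rule_approx]), and it always has a
    value, since orbit maps extend to the Stone-Cech compactification
    ([hull_rule_total]). Hence it is a binary operation, and the estimates on
    approximants give the axioms of a topological group
    ([hull_topological_group]).

    Conversely, suppose that the rule is a jointly continuous operation. It
    satisfies [w tau o w sigma = w (tau sigma)], because a point of [G] is one of
    the points of the compactification. Hence [f (s t)] is the value at [(1, 1)] of
    [w s o w t], that is, a jointly continuous function on the compact space
    [X_f * X_f] evaluated at [(w s, w t)]. Fixing one variable of such a function
    gives a family, indexed by a compact space, that depends continuously on its
    index for the supremum norm ([compact_family_precompact]); both families of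
    translates of [f] are of this form. *)

(** * Compactness, subspaces and uniform convergence *)

Section GeneralTopology.

Lemma cvg_set_val (X : topologicalType) (A : set X) (T : Type)
    (F : set_system T) (u : T -> A) (x : A) :
  Filter F -> (fun t => set_val (u t)) @ F --> set_val x -> u @ F --> x.
Proof.
move=> FF ux U [_ [[V oV <-] /= Vx] VU].
have /ux : nbhs (set_val x) V by exact: open_nbhs_nbhs.
by rewrite !nbhs_simpl /=; apply: filterS => t Vt; exact: VU.
Qed.

Lemma set_val_continuous (X : topologicalType) (A : set X) :
  continuous (set_val : A -> X).
Proof. exact: initial_continuous. Qed.

Lemma hausdorff_set_type (X : topologicalType) (A : set X) :
  hausdorff_space X -> hausdorff_space A.
Proof.
move=> hX x y xy; apply: val_inj; apply: hX => U V Ux Vy.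
have [z [Uz Vz]] := xy _ _ (set_val_continuous Ux) (set_val_continuous Vy).
by exists (set_val z).
Qed.

Lemma compact_set_type (X : topologicalType) (A : set X) :
  compact A -> compact [set: A].
Proof.
move=> cA F FF _.
have [|x [Ax xF]] := cA _ (fmap_proper_filter (set_val : A -> X) FF).
  by apply: (@filterE _ F) => x; exact: set_valP.
exists (exist _ x (mem_set Ax)); split=> // U V FU [_ [[W oW <-] /= Wx] WV].
have [|_ [[z Uz <-] Wz]] := xF (set_val @` U) W _ (open_nbhs_nbhs (conj oW Wx)).
  by apply: (@filterS _ F) FU => z Uz; exists z.
by exists z; split=> //; exact: WV.
Qed.

Lemma ptws_eval_continuous (X : topologicalType) (V : uniformType) (p : X) :
  continuous (fun x : {ptws X -> V} => x p).
Proof.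
move=> x; have xx : {ptws, nbhs x --> x} by [].
exact: (@pointwise_cvgP _ _ (nbhs x) x (nbhs_filter x)).1 xx p.
Qed.

(** The identity from the uniform to the pointwise topology is continuous, and
    the latter is Hausdorff, so on a uniformly compact set the two coincide. *)
Lemma cvg_uniform_of_compact (X : topologicalType) (V : uniformType)
    (T : Type) (F : set_system T) (A : set {uniform X -> V})
    (u : T -> {uniform X -> V}) (x : {uniform X -> V}) :
  hausdorff_space V -> Filter F -> compact A -> (\forall t \near F, A (u t)) ->
  (forall p, u t p @[t --> F] --> x p) -> u @ F --> x.
Proof.
move=> hV FF cA FA ux U Ux; apply: contrapT => nFU.
(* If [u] failed to be eventually in [U], the trace of [F] on the bad indices
   would have a uniform cluster point, which can only be [x]. *)
pose F' := within (~` (u @^-1` U)) F.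
have PF' : ProperFilter F'.
  apply: Build_ProperFilter_ex => B; rewrite /F' /within/= => FB.
  apply: contrapT => /forallNP nB; apply: nFU.
  by apply: filterS FB => t Bt; apply: contrapT => /Bt; exact: nB.
have F'F : F' `=>` F by exact: cvg_within.
have [|y [Ay yF']] := cA (u @ F') _; first exact: F'F.
suff yx : y = x.
  have [] := yF' (~` U) U; last by move=> z [].
    by rewrite nbhs_simpl /= /F' /within/=; apply: nearW.
  by rewrite yx.
apply/funext => p; apply/esym/hV => B D Bx Dy.
have [|//|z [Bz Dz]] := yF' [set z | B (z p)] [set z | D (z p)].
- exact/F'F/ux.
- have /pointwise_uniform_cvg/pointwise_cvgP : {uniform, nbhs y --> y} by [].
  by apply.
- by exists (z p).
Qed.

End GeneralTopology.

Definition uclose (X : Type) (K : numDomainType) (V : pseudoMetricType K) (e : K)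
    (x y : X -> V) : Prop :=
  forall p, ball (x p) e (y p).

Section UniformlyClose.
Context (X : Type) (K : numFieldType) (V : pseudoMetricType K).
Implicit Types (x y z : X -> V) (e : K).

Lemma uclose_refl e x : 0 < e -> uclose e x x.
Proof. by move=> e0 p; exact: ballxx. Qed.

Lemma uclose_sym e x y : uclose e x y -> uclose e y x.
Proof. by move=> xy p; exact: ball_sym. Qed.

Lemma uclose_trans e1 e2 x y z :
  uclose e1 x y -> uclose e2 y z -> uclose (e1 + e2) x z.
Proof. by move=> xy yz p; exact: ball_triangle (xy p) (yz p). Qed.

Lemma uclose_le e1 e2 x y : e1 <= e2 -> uclose e1 x y -> uclose e2 x y.
Proof. by move=> e12 xy p; exact: le_ball (xy p). Qed.

Lemma uclose_eq n x y :
  hausdorff_space V -> (forall e, 0 < e -> uclose (e *+ n.+1) x y) -> x = y.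
Proof.
move=> hV xy; apply/funext => p; apply: close_eq => //; rewrite ball_close => e.
have n0 : n.+1%:R != 0 :> K by rewrite pnatr_eq0.
rewrite -(divfK n0 e%:num) mulr_natr.
by apply: xy; rewrite divr_gt0 // ltr0n.
Qed.

End UniformlyClose.

Section UniformNbhs.
Context (X : choiceType) (K : numFieldType) (V : pseudoMetricType K).
Implicit Types (h : {uniform X -> V}) (e : K).

Lemma near_uclose h e : 0 < e -> \forall h' \near h, uclose e h h'.
Proof.
move=> e0; apply/uniform_nbhs; exists [set ab | ball ab.1 e ab.2].
split; first exact: entourage_ball (PosNum e0).
by move=> h' hh' p; exact: hh'.
Qed.

Lemma uniform_nbhs_uclose h (U : set {uniform X -> V}) :
  nbhs h U -> exists2 e, 0 < e & forall h', uclose e h h' -> U h'.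
Proof.
case/uniform_nbhs => E [+ EU]; rewrite -entourage_ballE => -[e e0 eE].
by exists e => // h' hh'; apply: EU => p _; apply: eE; exact: hh'.
Qed.

End UniformNbhs.

Lemma uniform_hausdorff (X : choiceType) (V : uniformType) :
  hausdorff_space V -> hausdorff_space {uniform X -> V}.
Proof.
move=> hV g h gh; have : close g h by rewrite closeEnbhs.
rewrite hausdorrf_close_eq_in // => ghE; apply/funext => x.
by apply: ghE; rewrite inE.
Qed.

(** By compactness of [L], a jointly continuous function on [L * M] is continuous
    in [m : M] uniformly in [l : L], so the family is the image of a compact
    space under a map that is continuous for the supremum norm. *)
Lemma compact_family_precompact (X : choiceType) (L M : topologicalType)
    (K : numFieldType) (V : pseudoMetricType K) (w : X -> L) (h : L * M -> V) :
  hausdorff_space V -> compact [set: L] -> compact [set: M] -> continuous h ->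
  precompact (range (fun m => (fun x => h (w x, m)) : {uniform X -> V})).
Proof.
move=> hV cL cM ch.
pose u m : {uniform X -> V} := fun x => h (w x, m).
apply: compact_precompact; first exact: uniform_hausdorff.
apply: (@continuous_compact _ _ u) => //; apply: continuous_subspaceT => m U.
case/uniform_nbhs_uclose => e e0 eU.
have e2 : 0 < e / 2 by rewrite divr_gt0.
pose P m' l := ball (h (l, m)) e (h (l, m')).
suff nearP : \forall m' \near m, [set: L] `<=` P m'.
  rewrite nbhs_simpl /=; apply: filterS nearP => m' Pm'.
  by apply: eU => x; exact: Pm'.
apply: (compact_near_coveringP [set: L]).1 => // l _.
have /cvg_ballP/(_ _ e2) := ch (l, m).
case=> -[A D] /= [lA mD] AD; exists (A, D) => // -[l' m'] /= [Al' Dm'].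
have Dm : D m by exact: nbhs_singleton.
have b := AD (l', m) (conj Al' Dm); have b' := AD (l', m') (conj Al' Dm').
rewrite /P (splitr e); exact: ball_triangle (ball_sym b) b'.
Qed.

(** The disk lies in the image of a square of [R * R], which is compact. *)
Lemma closed_disk_compact (R : realType) (r : R[i]) :
  exists2 D : set R[i]^o, compact D & forall z, `|z| <= r -> D z.
Proof.
pose c (ab : R * R) : R[i]^o := (ab.1 +i* ab.2)%C.
pose I := `[- complex.Re r, complex.Re r].
have sqrt_le (u v : R) : Num.sqrt (u ^+ 2 + v ^+ 2) <= `|u| + `|v|.
  rewrite -[leRHS]ger0_norm ?addr_ge0 // -[leRHS]sqrtr_sqr ler_sqrt ?sqr_ge0 //.
  rewrite sqrrD !real_normK ?num_real // addrAC.
  by rewrite lerDl mulrn_wge0 // mulr_ge0.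
exists (c @` ([set` I] `*` [set` I])); last first.
  case=> a b abr; exists (a, b) => //.
  have absr : Num.sqrt (a ^+ 2 + b ^+ 2) <= complex.Re r.
    by move: abr; rewrite normc_def /= lecE => /andP[].
  have ab0 : 0 <= a ^+ 2 + b ^+ 2 by rewrite addr_ge0 ?sqr_ge0.
  have leab x : x ^+ 2 <= a ^+ 2 + b ^+ 2 -> `|x| <= complex.Re r.
    by move=> xab; apply: le_trans absr; rewrite -sqrtr_sqr ler_sqrt.
  by split=> /=; rewrite in_itv /= -ler_norml leab // ?lerDl ?lerDr sqr_ge0.
apply: continuous_compact; last by apply: compact_setX; exact: segment_compact.
apply: continuous_subspaceT => -[a b]; apply/cvgrPdist_lt => e e0.
have /andP[/eqP ie0 re0] : (complex.Im e == 0) && (0 < complex.Re e).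
  by move: e0; rewrite ltcE /= eq_sym.
have e2 : 0 < complex.Re e / 2 by rewrite divr_gt0.
exists (ball a (complex.Re e / 2), ball b (complex.Re e / 2)) => /=.
  by split; exact: nbhsx_ballx.
case=> a' b' [/= ba bb].
rewrite /c /= normc_def ltcE /= ie0 eqxx /=.
rewrite /ball /= in ba bb.
apply: (@le_lt_trans _ _ (`|a - a'| + `|b - b'|)).
  exact: sqrt_le.
by rewrite (splitr (complex.Re e)) ltrD.
Qed.

(** * The Stone-Cech compactification *)

Section StoneCech.
Context (G : topGroupType) (B : topologicalType) (iota : G -> B).
Hypothesis betaP : is_stone_cech iota.

(** Density comes from the uniqueness part of the universal property: [iota]
    corestricted to the closure [D] of its range extends to [B -> D], and the
    composite [B -> D -> B] has to be the identity since both extend [iota]. *)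
Lemma stone_cech_dense (b : B) : closure (range iota) b.
Proof.
have [cB hB ci univ] := betaP.
pose D := closure (range iota).
have hD : hausdorff_space D by exact: hausdorff_set_type.
have cD : compact [set: D].
  apply: compact_set_type; apply: subclosed_compact cB _ => //.
  exact: closed_closure.
have Di t : iota t \in D by apply/mem_set/subset_closure; exists t.
pose j (t : G) : D := exist _ (iota t) (Di t).
have cj : continuous j by move=> t; apply: cvg_set_val; exact: ci.
have [g [[cg gj] _]] := univ _ j cD hD cj.
have [h [[ch hi] hU]] := univ _ iota cB hB ci.
have hid : h = id by apply: hU; split=> // b'; exact: cvg_id.
have hg : h = (fun b => set_val (g b)).
  apply: hU; split=> [b'|t]; last by rewrite gj.
  by apply: continuous_comp; [exact: cg|exact: set_val_continuous].
rewrite -[b]/(id b) -hid hg.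
exact: set_valP.
Qed.

Lemma trace_nbhs_proper (b : B) : ProperFilter (trace_nbhs iota b).
Proof.
apply: filter_from_proper => [|U /stone_cech_dense [_ [[t _ <-] Ut]]].
  apply: filter_from_filter; first by exists setT; exact: filterT.
  by move=> U V bU bV; exists (U `&` V) => //; exact: filterI.
by exists t.
Qed.

Lemma stone_cech_extension (K : topologicalType) (h : G -> K) :
  compact [set: K] -> hausdorff_space K -> continuous h ->
  exists g : B -> K, [/\ continuous g, (forall t, g (iota t) = h t) &
    forall b, h @ trace_nbhs iota b --> g b].
Proof.
move=> cK hK ch; have [_ _ _ /(_ K h cK hK ch) [g [[cg gh] _]]] := betaP.
exists g; split=> // b U /cg gU; exists (g @^-1` U) => // t /=.
by rewrite gh.
Qed.

End StoneCech.

Lemma cvg_mulg (G : topGroupType) (T : Type) (F : set_system T) (u v : T -> G)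
    (a b : G) :
  Filter F -> u @ F --> a -> v @ F --> b -> (u t * v t)%g @[t --> F] --> (a * b)%g.
Proof.
move=> FF ua vb.
have m : (st.1 * st.2)%g @[st --> (a, b)] --> (a * b)%g.
  exact (@mulg_continuous G (a, b)).
exact: (@continuous2_cvg _ _ _ _ F FF u v (fun x y => (x * y)%g) a b m ua vb).
Qed.

(** * The hull and its orbit map *)

Section Hull.
Context (R : realType) (G : topGroupType).
Local Notation C := (R[i]^o).
Local Notation PW := {ptws (G * G)%type -> C}.
Implicit Types (x y z : PW) (e : C).

Lemma C_hausdorff : hausdorff_space C.
Proof. exact: norm_hausdorff. Qed.

Lemma PW_hausdorff : hausdorff_space PW.
Proof.
by apply: (@hausdorff_product _ (fun=> C)) => p; exact: C_hausdorff.
Qed.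

Lemma cvg_ptws (T : Type) (F : set_system T) (u : T -> PW) x :
  Filter F -> (forall p, u t p @[t --> F] --> x p) -> u @ F --> x.
Proof. by move=> FF ux; apply/pointwise_cvgP. Qed.

Lemma uclose_cvg (T : Type) (F : set_system T) (u : T -> PW) x :
  Filter F -> (forall e, 0 < e -> \forall t \near F, uclose e x (u t)) ->
  u @ F --> x.
Proof.
move=> FF ux; apply: cvg_ptws => p; apply/cvg_ballP => e e0.
by apply: filterS (ux e e0) => t; exact.
Qed.

Lemma lact_continuous (t : G) : continuous (lact t : PW -> PW).
Proof.
move=> x.
apply: (@cvg_ptws _ (nbhs x) (lact t)).
move=> [a b].
exact: (@ptws_eval_continuous _ _ ((a * t)%g, b) x).
Qed.

Lemma lactM (s t : G) x : lact s (lact t x) = lact (s * t)%g x.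
Proof. by apply/funext => -[a b]; rewrite /lact /= mulgA. Qed.

Context (f : G -> C).

Lemma hull_lact tau x : hull f x -> hull f (lact tau x).
Proof.
move=> fx U /lact_continuous/fx [_ [[t _ <-] Ut]].
by exists (lact (tau * t)%g (xi f)); split; [exists (tau * t)%g|rewrite -lactM].
Qed.

Definition lact_hull (tau : G) (x : hull f) : hull f :=
  exist _ (lact tau (set_val x)) (mem_set (hull_lact (tau := tau) (set_valP x))).

Definition orbit_map (tau : G) : hull f := lact_hull tau (hull_xi f).

Lemma orbit_map1 : orbit_map 1%g = hull_xi f.
Proof.
by apply/val_inj/funext => -[s t]; rewrite /= /lact /xi /= mulg1.
Qed.

Lemma orbit_mapE tau s t : set_val (orbit_map tau) (s, t) = f (s * tau * t)%g.
Proof. by []. Qed.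

Lemma hull_hausdorff : hausdorff_space (hull f).
Proof. exact/hausdorff_set_type/PW_hausdorff. Qed.

Lemma hull_compact : bounded_fun f -> compact [set: hull f].
Proof.
case=> M [_ fM]; have [D cD MD] := closed_disk_compact (M + 1).
pose DD := [set x : PW | forall p, D (x p)].
have cDD : compact DD by exact: (@tychonoff _ (fun=> C) (fun=> D)).
apply: compact_set_type; apply: (subclosed_compact _ cDD).
  exact: closed_closure.
apply: subset_trans (closureS _) _; last first.
  by move=> x; apply: (compact_closed _ cDD); exact: PW_hausdorff.
by move=> _ [tau _ <-] p; apply: MD; apply: fM => //; rewrite ltrDl.
Qed.

Lemma orbit_map_continuous : continuous f -> continuous orbit_map.
Proof.
move=> cf tau; apply: cvg_set_val; apply: cvg_ptws => -[s t].
apply: (@cvg_comp _ _ _ (fun tau => s * tau * t)%g f); last exact: cf.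
apply: cvg_mulg; last exact: cvg_cst.
by apply: cvg_mulg; [exact: cvg_cst|exact: cvg_id].
Qed.

Lemma hull_eval_continuous p : continuous (fun x : hull f => set_val x p).
Proof.
move=> x; have e := @ptws_eval_continuous (G * G)%type C p (set_val x).
exact: (cvg_comp _ _ (@set_val_continuous _ _ x) e).
Qed.

Lemma hull_cvg (T : Type) (F : set_system T) (u : T -> hull f) (x : hull f) :
  Filter F ->
  (forall e, 0 < e -> \forall t \near F, uclose e (set_val x) (set_val (u t))) ->
  u @ F --> x.
Proof. by move=> FF ux; apply: cvg_set_val; exact: uclose_cvg. Qed.

End Hull.

(** * Pointwise and uniform convergence agree on the hull of an a.p. function *)

Section AlmostPeriodicHull.
Context (R : realType) (G : topGroupType).
Local Notation C := (R[i]^o).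
Context (f : G -> C).

Lemma orbit_map_dense (x : hull f) (U : set (hull f)) :
  nbhs x U -> exists tau, U (orbit_map f tau).
Proof.
case=> _ [[V oV <-] /= Vx] VU.
have [_ [[tau _ <-] Vtau]] := set_valP x _ (open_nbhs_nbhs (conj oV Vx)).
by exists tau; exact: VU.
Qed.

(** [trace_nbhs (orbit_map f) x] is the filter of those [tau] for which
    [orbit_map f tau] approaches [x]. *)
Lemma trace_orbit_proper (x : hull f) :
  ProperFilter (trace_nbhs (orbit_map f) x).
Proof.
apply: filter_from_proper => [|U /orbit_map_dense [tau Utau]].
  apply: filter_from_filter; first by exists setT; exact: filterT.
  by move=> U V xU xV; exists (U `&` V) => //; exact: filterI.
by exists tau.
Qed.

Hypothesis fap : left_ap f.

(** The compact set [A] of the proof serves twice. For a fixed [t] it contains all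
    functions [s |-> f (s tau t)], which makes the convergence uniform in [s]. It
    also contains all [rtrans t f], so it reduces the estimate to finitely many
    [t], up to a small error that does not depend on [s] and [tau]. *)
Lemma orbit_cvg_uclose (F : set_system G) (x : hull f) (e : C) :
  ProperFilter F -> orbit_map f @ F --> x -> 0 < e ->
  \forall tau \near F, uclose e (set_val x) (set_val (orbit_map f tau)).
Proof.
move=> PF Fx e0; have [A fA [cA _]] := fap.
have xF s t : f (s * tau * t)%g @[tau --> F] --> set_val x (s, t).
  exact: (cvg_comp _ _ Fx (@hull_eval_continuous _ _ f (s, t) x)).
(* The final estimate adds up seven errors [e']. *)
pose e' := e / 8%:R; have e'0 : 0 < e' by rewrite divr_gt0 // ltr0n.
pose P (tau : G) (h : {uniform G -> C}) := forall t, h = rtrans t f ->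
  forall s, ball (set_val x (s, t)) e (f (s * tau * t)%g).
suff nearP : \forall tau \near F, A `<=` P tau.
  apply: filterS nearP => tau H [s t].
  by apply: (H (rtrans t f)) => //; apply: fA; exists t.
apply: (compact_near_coveringP A).1 => // h Ah.
have nearh := near_uclose h e'0.
(* The compact set [A] may contain points far from all translates of [f]; such
   points have a neighbourhood where [P] holds vacuously. *)
have [[t0 ht0]|nh] := pselect (exists t0, uclose e' h (rtrans t0 f)); last first.
  exists ([set h' | uclose e' h h'], setT) => /=.
    by split; [exact: nearh|exact: filterT].
  by case=> h' tau /= [+ _] t h't; rewrite h't => ht; case: nh; exists t.
pose u tau : {uniform G -> C} := rtrans (tau * t0)%g f.
pose x0 : {uniform G -> C} := fun s => set_val x (s, t0).
have ux : u @ F --> x0.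
  apply: (cvg_uniform_of_compact (A := A)) => //.
  - by apply: filterE => tau; apply: fA; exists (tau * t0)%g.
  - move=> s; have := xF s t0; apply: cvg_trans.
    by apply: near_eq_cvg; apply: nearW => tau; rewrite /u /rtrans mulgA.
have nearu := ux [set h' | uclose e' x0 h'] (near_uclose x0 e'0).
exists ([set h' | uclose e' h h'],
    [set tau | uclose e' x0 (u tau)]) => /=.
  by split; [exact: nearh|exact: nearu].
case=> h' tau /= [hh' utau] t h't s.
have tt0 a : ball (f (a * t0)%g) (e' + e') (f (a * t)%g).
  have := hh' a; rewrite h't; apply: ball_triangle; exact/ball_sym/ht0.
have xt0 : ball (set_val x (s, t)) (e' + (e' + e') + e') (set_val x (s, t0)).
  have xb t' : \forall tau \near F, ball (set_val x (s, t')) e' (f (s * tau * t')%g).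
    by move/cvg_ballP: (xF s t'); apply.
  have [tau' [b1 b2]] := filter_ex (filterI (xb t) (xb t0)).
  apply: ball_triangle (ball_sym b2); apply: ball_triangle b1 _.
  exact/ball_sym/tt0.
have := utau s; rewrite /u /rtrans mulgA => ut0.
have := ball_triangle (ball_triangle xt0 ut0) (tt0 _); apply: le_ball.
have -> : e = e' *+ 8 by rewrite -mulr_natr divfK // pnatr_eq0.
by rewrite !mulrSr mulr0n add0r !addrA lerDl ltW.
Qed.

(** If all orbit points in an open neighbourhood of [x] are uniformly close to
    [x], then so are all its points, since each of them is a pointwise limit of
    orbit points in that neighbourhood. *)
Lemma hull_near_uclose (x : hull f) (e : C) :
  0 < e -> \forall y \near x, uclose e (set_val x) (set_val y).
Proof.
move=> e0; have e2 : 0 < e / 2 by rewrite divr_gt0.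
have PF := trace_orbit_proper x.
have Fx : orbit_map f @ trace_nbhs (orbit_map f) x --> x by move=> U xU; exists U.
have [U xU Utau] := orbit_cvg_uclose PF Fx e2.
apply: filterS (nbhs_interior xU) => y Uy p.
have /cvg_ballP/(_ _ e2) yp := @hull_eval_continuous _ _ f p y.
have [tau [/Utau xtau ytau]] := orbit_map_dense (filterI Uy yp).
rewrite (splitr e); exact: ball_triangle (xtau p) (ball_sym ytau).
Qed.

End AlmostPeriodicHull.

(** * The group law by uniform approximation *)

Section GroupLaw.
Context (R : realType) (G : topGroupType).
Local Notation C := (R[i]^o).
Context (f : G -> C).
Local Notation w := (orbit_map f).
Implicit Types (x y z : hull f) (e : C).

Definition hclose e x y := uclose e (set_val x) (set_val y).

(** The graph of the product: asking for approximants rather than for a limit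
    makes associativity, continuity and the other axioms finite estimates. *)
Definition approx_mul x y z := forall e, 0 < e -> exists tau sigma,
  [/\ hclose e x (w tau), hclose e y (w sigma) & hclose e z (w (tau * sigma)%g)].

Definition approx_inv x y := forall e, 0 < e -> exists tau,
  hclose e x (w tau) /\ hclose e y (w tau^-1%g).

Lemma lact_hull_orbit tau sigma : lact_hull tau (w sigma) = w (tau * sigma)%g.
Proof. by apply: val_inj; exact: lactM. Qed.

Lemma hclose_lact e tau x y :
  hclose e x y -> hclose e (lact_hull tau x) (lact_hull tau y).
Proof. by move=> xy p; exact: xy. Qed.

(** Two-sided invariance of the supremum distance, in the form of uniform
    continuity of the multiplication: [f (s tau sigma t)] is a value of [w tau] as
    well as of [w sigma]. *)
Lemma hclose_orbitM e1 e2 tau tau' sigma sigma' :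
  hclose e1 (w tau) (w tau') -> hclose e2 (w sigma) (w sigma') ->
  hclose (e1 + e2) (w (tau * sigma)%g) (w (tau' * sigma')%g).
Proof.
move=> ht hs [s t].
have := ht (s, (sigma * t)%g); have := hs ((s * tau')%g, t).
rewrite !orbit_mapE !mulgA => b2 b1; exact: ball_triangle b1 b2.
Qed.

(** Multiplying by [tau^-1] on the left and by [tau'^-1] on the right turns
    [tau'] into [tau^-1] and [tau] into [tau'^-1]. *)
Lemma hclose_orbitV e tau tau' :
  hclose e (w tau) (w tau') -> hclose e (w tau^-1%g) (w tau'^-1%g).
Proof.
move=> /uclose_sym ht [s t].
have := ht ((s * tau^-1)%g, (tau'^-1 * t)%g).
by rewrite !orbit_mapE mulgVK !mulgA mulgK.
Qed.

(** Each factor contributes three errors [e], the two products one each. *)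
Lemma approx_mul_close e x y z x' y' z' :
  approx_mul x y z -> approx_mul x' y' z' -> 0 < e ->
  hclose e x x' -> hclose e y y' -> hclose (e *+ 8) z z'.
Proof.
move=> + + e0 xx' yy'.
move=> /(_ e e0) [t [s [xt ys zts]]] /(_ e e0) [t' [s' [xt' ys' zts']]].
have tt' := uclose_trans (uclose_trans (uclose_sym xt) xx') xt'.
have ss' := uclose_trans (uclose_trans (uclose_sym ys) yy') ys'.
have := uclose_trans zts (uclose_trans (hclose_orbitM tt' ss') (uclose_sym zts')).
by rewrite !mulrSr mulr0n add0r !addrA.
Qed.

Lemma approx_inv_close e x y x' y' :
  approx_inv x y -> approx_inv x' y' -> 0 < e ->
  hclose e x x' -> hclose (e *+ 5) y y'.
Proof.
move=> + + e0 xx'.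
move=> /(_ e e0) [t [xt yt]] /(_ e e0) [t' [xt' yt']].
have tt' := uclose_trans (uclose_trans (uclose_sym xt) xx') xt'.
have := uclose_trans yt (uclose_trans (hclose_orbitV tt') (uclose_sym yt')).
by rewrite !mulrSr mulr0n add0r !addrA.
Qed.

Lemma hclose_eq n x y : (forall e, 0 < e -> hclose (e *+ n.+1) x y) -> x = y.
Proof. by move=> xy; apply/val_inj/uclose_eq; [exact: C_hausdorff|exact: xy]. Qed.

Lemma approx_mul_unique x y z z' : approx_mul x y z -> approx_mul x y z' -> z = z'.
Proof.
move=> m m'; apply: (@hclose_eq 7) => e e0.
by apply: (approx_mul_close m m' e0); exact: uclose_refl.
Qed.

Lemma approx_mul_orbit tau sigma : approx_mul (w tau) (w sigma) (w (tau * sigma)%g).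
Proof. by move=> e e0; exists tau, sigma; split; exact: uclose_refl. Qed.

Lemma approx_invC x y : approx_inv x y -> approx_inv y x.
Proof.
move=> xy e /xy [tau [xt yt]]; exists tau^-1%g; split=> //.
by rewrite invgK.
Qed.

Lemma approx_inv_mul x y : approx_inv x y -> approx_mul x y (hull_xi f).
Proof.
move=> xy e e0; have [tau [xt yt]] := xy e e0; exists tau, tau^-1%g; split=> //.
by rewrite mulgV orbit_map1; exact: uclose_refl.
Qed.

Hypothesis fap : left_ap f.

Lemma cvg_hclose (T : Type) (F : set_system T) (u : T -> hull f) e x :
  u @ F --> x -> 0 < e -> F [set t | hclose e x (u t)].
Proof. by move=> ux e0; exact: (ux _ (hull_near_uclose fap x e0)). Qed.

Lemma hclose_dense e x : 0 < e -> exists tau, hclose e x (w tau).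
Proof. by move=> /(hull_near_uclose fap x)/orbit_map_dense. Qed.

(** An equicontinuity argument: [y] is uniformly close to an orbit point, on which
    the action is continuous because [f] is. *)
Lemma lact_hull_continuous y : continuous f -> continuous (fun t => lact_hull t y).
Proof.
move=> cf tau; apply: hull_cvg => e e0.
pose e' := e / 3%:R; have e3 : 0 < e' by rewrite divr_gt0 // ltr0n.
have [sigma ys] := hclose_dense y e3.
have ts : (t * sigma)%g @[t --> tau] --> (tau * sigma)%g.
  by apply: cvg_mulg; [exact: cvg_id|exact: cvg_cst].
have wts := cvg_comp _ _ ts (@orbit_map_continuous _ _ f cf (tau * sigma)%g).
apply: filterS (cvg_hclose wts e3) => t /= {}ts.
have := uclose_trans (uclose_trans (hclose_lact tau ys) _) (uclose_sym (hclose_lact t ys)).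
rewrite !lact_hull_orbit => /(_ _ ts); apply: uclose_le.
have -> : e = e' *+ 3 by rewrite -mulr_natr divfK // pnatr_eq0.
by rewrite !mulrSr mulr0n add0r.
Qed.

End GroupLaw.

(** * The rule on the hull *)

Section BetaAction.
Context (R : realType) (G : topGroupType).
Local Notation C := (R[i]^o).
Context (betaG : topologicalType) (iota : G -> betaG).
Hypothesis betaP : is_stone_cech iota.
Context (f : G -> C).
Hypotheses (bf : bounded_fun f) (cf : continuous f).
Local Notation w := (orbit_map f).
Implicit Types x y z : hull f.

Lemma beta_act_hull (alpha : betaG) x y :
  is_beta_act iota alpha (set_val x) (set_val y) ->
  (fun t => lact_hull t x) @ trace_nbhs iota alpha --> y.
Proof.
move=> xy; have PF := trace_nbhs_proper betaP alpha.
exact: cvg_set_val.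
Qed.

Lemma beta_act_extension y : continuous (fun t => lact_hull t y) ->
  exists g : betaG -> hull f,
    [/\ continuous g, forall t, g (iota t) = lact_hull t y &
      forall alpha, is_beta_act iota alpha (set_val y) (set_val (g alpha))].
Proof.
move=> cy; have [g [cg gi gc]] :=
  stone_cech_extension betaP (hull_compact bf) (@hull_hausdorff _ _ f) cy.
exists g; split=> // alpha; have PF := trace_nbhs_proper betaP alpha.
exact: (cvg_comp _ _ (gc alpha) (@set_val_continuous _ _ (g alpha))).
Qed.

(** The [alpha xi_f] form a compact, hence closed, set that contains the dense
    orbit. *)
Lemma beta_act_xi_surj x :
  exists alpha, is_beta_act iota alpha (xi f) (set_val x).
Proof.
have [g [cg gi gact]] := beta_act_extension (orbit_map_continuous cf).
have [cB _ _ _] := betaP.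
have cl : closed (range g).
  apply: compact_closed; first exact: hull_hausdorff.
  by apply: continuous_compact => //; exact: continuous_subspaceT.
have [|alpha _ gx] := cl x; last by exists alpha; rewrite -gx; exact: gact.
move=> U /orbit_map_dense [tau Utau]; exists (w tau); split=> //.
by exists (iota tau).
Qed.

Lemma lact_orbit_continuous sigma : continuous (fun t => lact_hull t (w sigma)).
Proof.
move=> t; rewrite (_ : (fun t => _) = (fun t => w (t * sigma)%g)); last first.
  by apply/funext => t'; exact: lact_hull_orbit.
have ts : (t * sigma)%g @[t --> t] --> (t * sigma)%g.
  by apply: cvg_mulg; [exact: cvg_id|exact: cvg_cst].
exact: (cvg_comp _ _ ts (@orbit_map_continuous _ _ f cf (t * sigma)%g)).
Qed.

(** Elements of [G] act through their images in the compactification, so the rule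
    extends the product of [G]. *)
Lemma hull_rule_orbit tau sigma : hull_rule iota (w tau) (w sigma) (w (tau * sigma)%g).
Proof.
have [g [_ gi gact]] := beta_act_extension (orbit_map_continuous cf).
have [g' [_ gi' gact']] := beta_act_extension (lact_orbit_continuous (sigma := sigma)).
exists (iota tau), (iota sigma); split.
- by have := gact (iota tau); rewrite gi.
- by have := gact (iota sigma); rewrite gi.
- by have := gact' (iota tau); rewrite gi' lact_hull_orbit.
Qed.

(** By the identity [f (s t) = (w s o w t) (1, 1)], the translates of [f] arise
    from a jointly continuous function on a compact square by fixing one of its
    variables. *)
Lemma topological_group_ap (op : hull f -> hull f -> hull f) :
  (forall x y z, hull_rule iota x y z -> op x y = z) ->
  continuous (fun xy : hull f * hull f => op xy.1 xy.2) -> AP f.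
Proof.
move=> opP cop.
have opw tau sigma : op (w tau) (w sigma) = w (tau * sigma)%g.
  exact/opP/hull_rule_orbit.
have fE (s t : G) : f (s * t)%g = set_val (op (w s) (w t)) (1%g, 1%g).
  by rewrite opw orbit_mapE mul1g mulg1.
have hc := hull_compact bf.
pose h (xy : hull f * hull f) : C := set_val (op xy.1 xy.2) (1%g, 1%g).
have ch : continuous h.
  move=> xy; exact: (cvg_comp _ _ (cop xy) (@hull_eval_continuous _ _ f _ _)).
have ch' : continuous (fun yx : hull f * hull f => h (yx.2, yx.1)).
  by move=> yx; exact: (cvg_comp _ _ (@swap_continuous _ _ yx) (ch (yx.2, yx.1))).
split.
- apply: precompact_subset (compact_family_precompact w (@C_hausdorff R) hc hc ch).
  by move=> _ [t _ <-]; exists (w t) => //; apply/funext => x; rewrite /rtrans fE.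
- apply: precompact_subset (compact_family_precompact w (@C_hausdorff R) hc hc ch').
  by move=> _ [t _ <-]; exists (w t) => //; apply/funext => x; rewrite /ltrans fE.
Qed.

Hypothesis fap : left_ap f.

(** If [w tau] is close to [x], [tau y] close to [z] and [w sigma] close to [y],
    then [w (tau sigma) = tau (w sigma)] is close to [tau y], hence to [z]. *)
Lemma hull_rule_approx x y z : hull_rule iota x y z -> approx_mul x y z.
Proof.
case=> alpha [_ [ax _ yz]] e e0; have e2 : 0 < e / 2 by rewrite divr_gt0.
have PF := trace_nbhs_proper betaP alpha.
have nx := cvg_hclose fap (beta_act_hull (x := hull_xi f) ax) e0.
have nz := cvg_hclose fap (beta_act_hull yz) e2.
have [tau [xt zt]] := filter_ex (filterI nx nz).
have [sigma ys] := hclose_dense fap y e2.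
exists tau, sigma; split=> //.
  by apply: uclose_le ys; rewrite ler_pdivrMr // ler_pMr // ler1n.
rewrite (splitr e) -lact_hull_orbit.
exact: uclose_trans zt (hclose_lact tau ys).
Qed.

Lemma hull_rule_total x y : exists z, hull_rule iota x y z.
Proof.
have [alpha ax] := beta_act_xi_surj x; have [gamma gy] := beta_act_xi_surj y.
have [g [_ _ gact]] := beta_act_extension (@lact_hull_continuous _ _ f fap y cf).
by exists (g alpha), alpha, gamma; split.
Qed.

(** Extending [tau |-> w tau^-1] to the compactification gives a limit of the
    inverses along the same [alpha] that represents [x]. *)
Lemma approx_inv_total x : exists y, approx_inv x y.
Proof.
have cV : continuous (fun t => w t^-1%g).
  move=> t; exact: (cvg_comp _ _ (@invg_continuous G t) (@orbit_map_continuous _ _ f cf _)).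
have [g [cg gi gc]] :=
  stone_cech_extension betaP (hull_compact bf) (@hull_hausdorff _ _ f) cV.
have [alpha ax] := beta_act_xi_surj x.
exists (g alpha) => e e0; have PF := trace_nbhs_proper betaP alpha.
have nx := cvg_hclose fap (beta_act_hull (x := hull_xi f) ax) e0.
have ny := cvg_hclose fap (gc alpha) e0.
by have [tau [xt yt]] := filter_ex (filterI nx ny); exists tau.
Qed.

Lemma hull_topological_group (op : hull f -> hull f -> hull f) :
  (forall x y, approx_mul x y (op x y)) -> is_topological_group op (hull_xi f).
Proof.
move=> opP.
have opE x y z : approx_mul x y z -> op x y = z by exact: approx_mul_unique.
have op_close (e : C) x y tau sigma : 0 < e -> hclose e x (w tau) ->
    hclose e y (w sigma) -> hclose (e *+ 8) (op x y) (w (tau * sigma)%g).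
  exact: approx_mul_close (opP x y) (approx_mul_orbit f tau sigma).
have [inv invP] := choice approx_inv_total.
have le8 (e : C) : 0 < e -> e <= e *+ 8 by move=> /ltW e0; rewrite mulrS lerDl mulrn_wge0.
split.
(* The estimate [op_close] is used twice on each side: 64 errors [e] for either
   bracketing, and 127 is the predecessor of their sum. *)
- move=> x y z; apply: (@hclose_eq _ _ _ 127) => e e0.
  have [t xt] := hclose_dense fap x e0; have [s ys] := hclose_dense fap y e0.
  have [r zr] := hclose_dense fap z e0.
  have e8 : 0 < e *+ 8 by rewrite pmulrn_lgt0.
  have up (u v : hull f) : hclose e u v -> hclose (e *+ 8) u v by exact/uclose_le/le8.
  have l := op_close _ _ _ _ _ e8 (up _ _ xt) (op_close _ _ _ _ _ e0 ys zr).
  have r' := op_close _ _ _ _ _ e8 (op_close _ _ _ _ _ e0 xt ys) (up _ _ zr).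
  rewrite mulgA in l; have := uclose_trans l (uclose_sym r').
  by rewrite -!mulrnA -mulrnDr.
- move=> y; apply: opE => e e0; have [s ys] := hclose_dense fap y e0.
  exists 1%g, s; split=> //; last by rewrite mul1g.
  by rewrite orbit_map1; exact: uclose_refl.
- move=> x; apply: opE => e e0; have [t xt] := hclose_dense fap x e0.
  exists t, 1%g; split=> //; last by rewrite mulg1.
  by rewrite orbit_map1; exact: uclose_refl.
- case=> x y; apply: hull_cvg => e e0.
  pose e' := e / 8%:R; have e'0 : 0 < e' by rewrite divr_gt0 // ltr0n.
  exists ([set x' | hclose e' x x'], [set y' | hclose e' y y']) => /=.
    by split; exact: hull_near_uclose.
  case=> x' y' /= [xx' yy'].
  have -> : e = e' *+ 8 by rewrite -mulr_natr divfK // pnatr_eq0.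
  exact: approx_mul_close (opP x y) (opP x' y') e'0 xx' yy'.
- exists inv; split.
  + by move=> x; apply/opE/approx_inv_mul/approx_invC.
  + by move=> x; exact/opE/approx_inv_mul.
  + move=> x; apply: (@hull_cvg _ _ _ _ _ _ _ (nbhs_filter x)) => e e0.
    pose e' := e / 5%:R; have e'0 : 0 < e' by rewrite divr_gt0 // ltr0n.
    have sub x' : hclose e' x x' -> hclose e (inv x) (inv x').
      have -> : e = e' *+ 5 by rewrite -mulr_natr divfK // pnatr_eq0.
      exact: approx_inv_close (invP x) (invP x') e'0.
    exact: (filterS sub (hull_near_uclose fap x e'0)).
Qed.

Lemma ap_hull_group : exists op : hull f -> hull f -> hull f,
  (forall x y z, op x y = z <-> hull_rule iota x y z) /\
  is_topological_group op (hull_xi f).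
Proof.
have [op opP] := choice (fun xy : hull f * hull f => hull_rule_total xy.1 xy.2).
exists (fun x y => op (x, y)); split.
  move=> x y z; split=> [<-|/hull_rule_approx xyz]; first exact: (opP (x, y)).
  exact: approx_mul_unique (hull_rule_approx (opP (x, y))) xyz.
by apply: hull_topological_group => x y; exact: hull_rule_approx (opP (x, y)).
Qed.

End BetaAction.

Theorem theorem6p3 (R : realType) (G : topGroupType)
    (lcG : locally_compact [set: G]) (hausG : hausdorff_space G)
    (betaG : topologicalType) (iota : G -> betaG)
    (betaP : is_stone_cech iota)
    (f : G -> R[i]^o) (fUC : UC f) :
  AP f <->
  exists op : hull f -> hull f -> hull f,
    [/\ forall x y z : hull f, op x y = z <-> hull_rule iota x y z,
        compact [set: hull f],
        hausdorff_space (hull f) &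
        is_topological_group op (hull_xi f)].
Proof.
have [[bf cf _] _] := fUC; split.
  case=> fap _; have [op [opP opG]] := ap_hull_group betaP bf cf fap.
  exists op; split=> //; first exact: hull_compact.
  exact: hull_hausdorff.
case=> op [opP _ _ [_ _ _ cop _]].
by apply: (topological_group_ap betaP bf cf _ cop) => x y z /opP.
Qed.
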